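(* There exist nonnegative integers $a,b,c$ and $a',b',c'$, independent of all data below, such that the following holds. Let $(x_n),(y_n)$ be the sequences generated by the stochastic Halpern-Mann iteration $$y_n:=(1-\alpha_n)(Tx_n+\xi_n)+\alpha_nu,\qquad x_{n+1}:=(1-\beta_n)(Uy_n+\delta_n)+\beta_ny_n$$ with parameters $\alpha_n=\frac{2}{n+2}$ and $\beta_n=\beta\in(0,1)$ for all $n\in\mathbb{N}$. Assume that $K_0\in\mathbb{N}^*$ is such that $\mathbb{E}[\|Tx_n-u\|],\mathbb{E}[\|Uy_n-y_n\|],\mathbb{E}[\|Uu-u\|],\mathbb{E}[\|Uy_n-u\|]\le K_0$ for all $n\in\mathbb{N}$. Also, assume that $\mathbb{E}[\|\xi_n\|]\le K_1/(n+2)^2$ and $\mathbb{E}[\|\delta_n\|]\le K_2/(n+2)^2$ for all $n\in\mathbb{N}$. Then $$\mathbb{E}[\|y_n-y_{n+1}\|]\le\frac{2L}{n+2}$$ for all $n\in\mathbb{N}$, where $L:=aK_0+bK_1+cK_2$. If moreover there is a nonnegative random variable $Y$ with $\mathbb{E}[Y]\le K_0$ such that for all $n\in\mathbb{N}$, $\|Tx_n-u\|,\|Uy_n-y_n\|,\|Uu-u\|,\|Uy_n-u\|\le Y$ almost surely, then $$\mathbb{P}\left(\exists i\ge n\,(\|y_i-y_{i+1}\|\ge\varepsilon)\right)\le\frac1\varepsilon\,\frac{4L'}{n+2}$$ for all $n\in\mathbb{N}$ and $\varepsilon>0$, where $L':=a'K_0+b'K_1+c'K_2$.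
   Context: $\mathbb{N}=\{0,1,2,\dots\}$, $\mathbb{N}^*=\mathbb{N}\setminus\{0\}$. $(\Omega,\mathcal{F},\mathbb{P})$ is a probability space, $(X,\|\cdot\|)$ is a separable real normed space, and an $X$-valued random variable is a measurable function $\Omega\to X$. $T,U:X\to X$ are nonexpansive ($\|Tx-Ty\|\le\|x-y\|$, $\|Ux-Uy\|\le\|x-y\|$ for all $x,y\in X$); $x_0$ (the starting point) and $u$ (the anchor) are arbitrary $X$-valued random variables; $(\xi_n),(\delta_n)$ are sequences of $X$-valued random variables; $K_1,K_2\ge0$ are real constants. *)

(* Defs.v *)
From HB Require Import structures.
From mathcomp Require Import all_boot all_order all_algebra.
From mathcomp Require Import all_classical all_reals all_analysis.

Set Implicit Arguments.
Unset Strict Implicit.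
Unset Printing Implicit Defensive.

Import Order.TTheory GRing.Theory Num.Theory.
Import numFieldNormedType.Exports.

Local Open Scope classical_set_scope.
Local Open Scope ring_scope.

Definition separable (X : topologicalType) : Prop :=
  exists2 D : set X, countable D & dense D.

(* X carries its Borel sigma-algebra, generated by the open sets. *)
Definition X_random_variable (R : realType) (X : normedModType R)
    (d : measure_display) (Omega : measurableType d) (f : Omega -> X) : Prop :=
  measurable_fun [set: Omega] (f : Omega -> g_sigma_algebraType (@open X)).

Definition nonexpansive (R : realType) (X : normedModType R) (T : X -> X) :
    Prop :=
  forall x y : X, `|T x - T y| <= `|x - y|.

Definition halpern_mann (R : realType) (X : normedModType R) (Omega : Type)
    (T U : X -> X) (alpha beta : nat -> R) (x0 u : Omega -> X)
    (xi delta x y : nat -> Omega -> X) : Prop :=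
  [/\ forall w, x 0%N w = x0 w,
      forall n w, y n w =
        (1 - alpha n) *: (T (x n w) + xi n w) + alpha n *: u w
    & forall n w, x n.+1 w =
        (1 - beta n) *: (U (y n w) + delta n w) + beta n *: y n w].

(* Main.v *)
Require Import Defs.
From HB Require Import structures.
From mathcomp Require Import all_boot all_order all_algebra.
From mathcomp Require Import all_classical all_reals all_analysis.
From mathcomp Require Import measurable_realfun.
From mathcomp Require Import ring lra.

Set Implicit Arguments.
Unset Strict Implicit.
Unset Printing Implicit Defensive.

Import Order.TTheory GRing.Theory Num.Theory.
Import numFieldNormedType.Exports.

Local Open Scope classical_set_scope.
Local Open Scope ring_scope.

(** The iteration contracts its own successive differences up to summable
    errors. Write D_n for |y_n - y_(n+1)|. Subtracting two consecutive steps,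
    nonexpansiveness of T and U gives, at each point of the sample space,
      D_(n+1) <= (1 - alpha_(n+2)) (D_n + |delta_n| + |delta_(n+1)|)
                 + |xi_(n+1)| + |xi_(n+2)|
                 + (alpha_(n+1) - alpha_(n+2)) |T x_(n+1) - u|.
    For alpha_n = 2 / (n + 2) the contraction factor is (n + 2) / (n + 4), so
    multiplication by (n + 3) (n + 4) turns the recursion into a telescoping
    one: (n + 2) (n + 3) D_n is bounded by a sum of n + 1 nonnegative
    increments (gap_le_sum). The weights are cancelled by the decay of the
    noise and by the size 2 / ((n + 3) (n + 4)) of alpha_(n+1) - alpha_(n+2),
    so every increment has mean at most L = 2 K0 + 3 K1 + 3 K2
    (mean_le_gap_increment). Hence the mean of D_n is at most
    (n + 1) L / ((n + 2) (n + 3)), below 2 L / (n + 2).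

    The increments being nonnegative, the same pointwise bound controls all
    D_i with i >= n at once. With v_i = 1 / ((i + 2) (i + 3)), which is
    nonincreasing, v_i times the i-th partial sum of the increments is at most
    the single weighted sum of the k-th increments with weights v_(max(n, k)),
    and these weights add up to at most 2 / (n + 2) because v telescopes. The
    Markov inequality applied to this weighted sum yields the tail bound
    (maximal_inequality).

    Means of sums are sums of means only for measurable functions. That the
    iterates are random variables rests on separability: it makes the Borel
    sigma-algebra of X * X the product one, so that sums of random variables
    are random variables (random_variable_comp2). *)

(** * Random variables in a separable normed space *)

Lemma random_variable_open (R : realType) (X : normedModType R)
    (d : measure_display) (Omega : measurableType d) (f : Omega -> X)
    (O : set X) :
  X_random_variable f -> open O -> measurable (f @^-1` O).
Proof.
move=> mf oO; rewrite -[X in measurable X]setTI; apply: mf => //.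
exact: sub_sigma_algebra.
Qed.

Lemma random_variable_preimage_open (R : realType) (X : normedModType R)
    (d : measure_display) (Omega : measurableType d) (f : Omega -> X) :
  (forall O : set X, open O -> measurable (f @^-1` O)) -> X_random_variable f.
Proof.
move=> mf; apply: (@measurability _ _ Omega (g_sigma_algebraType (@open X)) setT
  (f : Omega -> g_sigma_algebraType (@open X)) (@open X)) => //.
by move=> _ [U oU <-]; rewrite setTI; exact: mf.
Qed.

Lemma random_variable_comp (R : realType) (X : normedModType R)
    (d : measure_display) (Omega : measurableType d)
    (F : X -> X) (f : Omega -> X) :
  continuous F -> X_random_variable f -> X_random_variable (F \o f).
Proof.
move=> cF mf; apply: random_variable_preimage_open => O oO.
rewrite comp_preimage; apply: (random_variable_open mf).
by apply: open_comp => // x _; exact: cF.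
Qed.

Lemma separable_enum (R : realType) (X : normedModType R) : separable X ->
  exists q : nat -> X, forall (x : X) (e : R), 0 < e ->
    exists i, ball x e (q i).
Proof.
move=> [D /pfcard_geP[D0|[q]] dD].
  have [] := dD setT; [by exists 0|exact: openT|].
  by move=> x [_]; rewrite D0.
exists q => x e e0.
have [] := dD (ball x e); [by exists x; exact: ballxx|exact: ball_open|].
move=> z [xz Dz].
have [i _ qi] := @surj _ _ _ _ q _ Dz.
by exists i; rewrite qi.
Qed.

(** An open subset of X * X is a countable union of boxes whose sides are balls
    centered in a dense sequence with radii 1 / (k + 1); the preimage of such a
    box is an intersection of two measurable sets. *)
Lemma random_variable_comp2 (R : realType) (X : normedModType R)
    (d : measure_display) (Omega : measurableType d)
    (F : X * X -> X) (f g : Omega -> X) :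
  separable X -> continuous F -> X_random_variable f -> X_random_variable g ->
  X_random_variable (fun w => F (f w, g w)).
Proof.
move=> /separable_enum[q dq] cF mf mg.
apply: random_variable_preimage_open => O oO.
(* Two such radii must fit inside the ball given by openness, whence e / 2
   below. *)
pose r k : R := k.+1%:R^-1.
pose good (t : nat * nat * nat) := forall a b : X,
  ball (q t.1.1) (r t.2) a -> ball (q t.1.2) (r t.2) b -> O (F (a, b)).
pose box (t : nat * nat * nat) : set Omega :=
  [set w | good t] `&` (f @^-1` ball (q t.1.1) (r t.2) `&`
                        g @^-1` ball (q t.1.2) (r t.2)).
have r0 k : 0 < r k by rewrite /r invr_gt0 ltr0Sn.
suff -> : (fun w => F (f w, g w)) @^-1` O = \bigcup_t box t.
  apply: countable_bigcupT_measurable => [|t]; first exact: countableP.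
  have [gt|ngt] := pselect (good t).
    rewrite /box (_ : [set _ | _] = setT); last by apply/seteqP; split.
    rewrite setTI; apply: measurableI.
      by apply: (random_variable_open mf); exact: ball_open.
    by apply: (random_variable_open mg); exact: ball_open.
  rewrite /box (_ : [set _ | _] = set0) ?set0I//.
  by apply/seteqP; split.
apply/seteqP; split => w /=; last first.
  by move=> [t _ [gt [fw gw]]]; exact: gt.
move=> Ow.
have : nbhs (f w, g w) (F @^-1` O).
  by apply: cF; exact: open_nbhs_nbhs.
move=> /nbhs_ballP[e /= e0 eO].
have [k ke] : exists k, r k < e / 2.
  have /cvgrPdist_lt/(_ (e / 2)) := @cvg_harmonic R.
  rewrite divr_gt0// => /(_ isT)[k _ /(_ k (leqnn k))].
  by rewrite /= sub0r normrN gtr0_norm ?invr_gt0 ?ltr0Sn// => ?; exists k.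
have [i fi] := dq (f w) _ (r0 k).
have [j gj] := dq (g w) _ (r0 k).
exists (i, j, k) => //; split; last by split; exact: ball_sym.
move=> a b /= ia jb; apply: eO; split => /=; rewrite [e]splitr.
- apply: (@ball_triangle _ _ (q i)).
    by apply: le_ball fi; exact: ltW.
  by apply: le_ball ia; exact: ltW.
- apply: (@ball_triangle _ _ (q j)).
    by apply: le_ball gj; exact: ltW.
  by apply: le_ball jb; exact: ltW.
Qed.

Lemma measurable_norm_random_variable (R : realType) (X : normedModType R)
    (d : measure_display) (Omega : measurableType d) (f : Omega -> X) :
  X_random_variable f -> measurable_fun [set: Omega] (fun w => `|f w|).
Proof.
move=> mf; apply: (measurability _ (RGenOInfty.measurableE R)) => //.
move=> _ [_ [a ->] <-]; rewrite setTI.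
rewrite (_ : _ @^-1` _ = f @^-1` (@Num.norm R X @^-1` [set z | a < z])).
  apply: (random_variable_open mf); apply: open_comp; last exact: open_gt.
  by move=> z _; exact: norm_continuous.
by apply/seteqP; split => w /=; rewrite in_itv/= andbT.
Qed.

Lemma nonexpansive_continuous (R : realType) (X : normedModType R) (T : X -> X) :
  nonexpansive T -> continuous T.
Proof.
move=> nT x; apply/cvgrPdist_lt => e e0; near=> z.
apply: le_lt_trans (nT _ _) _.
near: z; exact: cvgr_dist_lt.
Unshelve. all: by end_near. Qed.

Lemma random_variableD (R : realType) (X : normedModType R)
    (d : measure_display) (Omega : measurableType d) (f g : Omega -> X) :
  separable X -> X_random_variable f -> X_random_variable g ->
  X_random_variable (fun w => f w + g w).
Proof.
move=> sX mf mg.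
by apply: (random_variable_comp2 (F := fun z => z.1 + z.2) sX _ mf mg);
  exact: add_continuous.
Qed.

Lemma random_variableZ (R : realType) (X : normedModType R)
    (d : measure_display) (Omega : measurableType d) (k : R) (f : Omega -> X) :
  X_random_variable f -> X_random_variable (fun w => k *: f w).
Proof.
by move=> mf; exact: (random_variable_comp (@scaler_continuous R X k) mf).
Qed.

Lemma random_variableB (R : realType) (X : normedModType R)
    (d : measure_display) (Omega : measurableType d) (f g : Omega -> X) :
  separable X -> X_random_variable f -> X_random_variable g ->
  X_random_variable (fun w => f w - g w).
Proof.
move=> sX mf mg; under eq_fun do rewrite -scaleN1r.
by apply: random_variableD => //; exact: random_variableZ.
Qed.

Lemma halpern_mann_random_variable (R : realType) (X : normedModType R)
    (d : measure_display) (Omega : measurableType d)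
    (T U : X -> X) (alpha beta : nat -> R) (x0 u : Omega -> X)
    (xi delta x y : nat -> Omega -> X) :
  separable X -> nonexpansive T -> nonexpansive U ->
  X_random_variable x0 -> X_random_variable u ->
  (forall n, X_random_variable (xi n)) ->
  (forall n, X_random_variable (delta n)) ->
  halpern_mann T U alpha beta x0 u xi delta x y ->
  forall n, X_random_variable (x n) /\ X_random_variable (y n).
Proof.
move=> sX /nonexpansive_continuous cT /nonexpansive_continuous cU.
move=> mx0 mu mxi mdelta [x0E yE xE].
have my n : X_random_variable (x n) -> X_random_variable (y n).
  move=> mx; rewrite (funext (yE n)).
  apply: random_variableD => //; apply: random_variableZ => //.
  by apply: random_variableD => //; exact: (random_variable_comp cT).
elim=> [|n [mx my']].
  by rewrite (funext x0E); split => //; apply: my; rewrite (funext x0E).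
suff mxS : X_random_variable (x n.+1) by split => //; exact: my.
rewrite (funext (xE n)).
apply: random_variableD => //; apply: random_variableZ => //.
by apply: random_variableD => //; exact: (random_variable_comp cU).
Qed.

(** * Bounds on means and a maximal inequality *)

(** Bundles an upper bound on a mean with what makes it additive and
    homogeneous: a bare bound on the integral of a function that is not
    measurable would not survive sums. *)
Definition mean_le (R : realType) (d : measure_display)
    (Omega : measurableType d) (P : probability Omega R)
    (f : Omega -> R) (a : R) : Prop :=
  [/\ measurable_fun [set: Omega] f, forall w, 0 <= f w
    & ('E_P[f] <= a%:E)%E].

Lemma mean_leW (R : realType) (d : measure_display)
    (Omega : measurableType d) (P : probability Omega R)
    (f : Omega -> R) (a b : R) : a <= b -> mean_le P f a -> mean_le P f b.
Proof.
by move=> ab [mf f0 fa]; split => //; apply: le_trans fa _; rewrite lee_fin.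
Qed.

Lemma mean_leD (R : realType) (d : measure_display)
    (Omega : measurableType d) (P : probability Omega R) (f g : Omega -> R)
    (a b : R) : mean_le P f a -> mean_le P g b ->
  mean_le P (fun w => f w + g w) (a + b).
Proof.
move=> [mf f0 fa] [mg g0 gb]; split; first exact: measurable_funD.
  by move=> w; rewrite addr_ge0.
apply: le_trans (leeD fa gb).
rewrite unlock -ge0_integralD//.
- by move=> w _; rewrite /= lee_fin.
- exact/measurable_EFinP.
- by move=> w _; rewrite /= lee_fin.
- exact/measurable_EFinP.
Qed.

Lemma mean_leZ (R : realType) (d : measure_display)
    (Omega : measurableType d) (P : probability Omega R) (f : Omega -> R)
    (k a : R) : 0 <= k -> mean_le P f a -> mean_le P (fun w => k * f w) (k * a).
Proof.
move=> k0 [mf f0 fa]; split; first exact: measurable_funM.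
  by move=> w; rewrite mulr_ge0.
rewrite EFinM; apply: le_trans (lee_wpmul2l _ fa); last by rewrite lee_fin.
rewrite unlock -ge0_integralZl_EFin//.
- by move=> w _; rewrite /= lee_fin.
- exact/measurable_EFinP.
Qed.

Lemma mean_le_sum (R : realType) (d : measure_display)
    (Omega : measurableType d) (P : probability Omega R) (c : nat -> R)
    (f : nat -> Omega -> R) (a : R) (n : nat) :
  (forall k, 0 <= c k) -> (forall k, mean_le P (f k) a) ->
  mean_le P (fun w => \sum_(0 <= k < n) c k * f k w)
            ((\sum_(0 <= k < n) c k) * a).
Proof.
move=> c0 fa; elim: n => [|n ih].
  rewrite big_nil mul0r (_ : (fun _ => _) = cst 0).
    by split => //; rewrite expectation_cst.
  by apply/funext => w; rewrite big_nil.
rewrite big_nat_recr//= mulrDl.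
under eq_fun do rewrite big_nat_recr//=.
by apply: mean_leD ih _; exact: mean_leZ.
Qed.

Lemma measurable_superlevel (R : realType) (d : measure_display)
    (Omega : measurableType d) (f : Omega -> R) (a : R) :
  measurable_fun [set: Omega] f -> measurable [set w | a <= f w].
Proof.
move=> mf; rewrite -[X in measurable X]setTI.
have := measurable_fun_ler (@measurable_cst _ _ Omega R setT a) mf.
by move=> /(_ measurableT [set true] I).
Qed.

Lemma mean_le_markov (R : realType) (d : measure_display)
    (Omega : measurableType d) (P : probability Omega R)
    (f : Omega -> R) (a eps : R) : 0 < eps -> mean_le P f a ->
  (P [set w | (eps <= f w)%R] <= (1 / eps * a)%:E)%E.
Proof.
move=> e0 [mf f0 fa]; rewrite div1r EFinM lee_pdivlMl//; apply: le_trans fa.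
have := @le_integral_comp_abse _ _ _ P setT measurableT (EFin \o f) eps id.
move=> /(_ (@measurable_id _ _ _) (fun r h => h) (fun x y _ _ h => h)).
move=> /(_ ((measurable_EFinP _ _).2 mf) e0); rewrite setTI unlock.
have nf w : (`|(EFin \o f) w| = (f w)%:E)%E by rewrite /= ger0_norm.
under eq_integral do rewrite nf.
by under eq_set do rewrite nf lee_fin.
Qed.

(** For nonnegative weights the right-hand side is nondecreasing in i, so it
    bounds the left-hand side for all indices between n and i at once. *)
Lemma weighted_sum_le_majorant (R : realType) (v f : nat -> R) (n i : nat) :
  (forall k, 0 <= f k) -> {homo v : i j / (i <= j)%N >-> j <= i} ->
  (n <= i)%N ->
  v i * \sum_(0 <= k < i.+1) f k <= \sum_(0 <= k < i.+1) v (maxn n k) * f k.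
Proof.
move=> f0 dv ni; rewrite mulr_sumr; apply: ler_sum_nat => k /andP[_ ki].
by rewrite ler_wpM2r// dv// geq_max ni.
Qed.

Lemma mean_le_ge (R : realType) (d : measure_display)
    (Omega : measurableType d) (P : probability Omega R)
    (f g : Omega -> R) (a : R) : measurable_fun [set: Omega] f ->
  (forall w, 0 <= f w) -> (forall w, f w <= g w) -> mean_le P g a ->
  mean_le P f a.
Proof.
move=> mf f0 fg [mg g0 ga]; split => //; apply: le_trans ga.
by apply: expectation_le => //; exact: aeW.
Qed.

(** A tail bound of Hajek-Renyi type. All the events g i >= eps with
    n <= i < m lie in one superlevel set of the m-th weighted sum Z m, to which
    the Markov inequality applies with a constant independent of m; these
    superlevel sets increase with m, so the bound passes to their union. *)
Lemma maximal_inequality (R : realType) (d : measure_display)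
    (Omega : measurableType d) (P : probability Omega R) (v : nat -> R)
    (f g : nat -> Omega -> R) (C M eps : R) (n : nat) :
  (forall i, measurable_fun [set: Omega] (g i)) ->
  (forall i w, g i w <= v i * \sum_(0 <= k < i.+1) f k w) ->
  (forall k, mean_le P (f k) C) -> 0 <= C ->
  (forall k, 0 <= v k) -> {homo v : i j / (i <= j)%N >-> j <= i} ->
  (forall m, \sum_(0 <= k < m) v (maxn n k) <= M) -> 0 < eps ->
  (P [set w | exists i : nat, (n <= i)%N /\ (eps <= g i w)%R]
     <= (1 / eps * (M * C))%:E)%E.
Proof.
move=> mg gS fC C0 v0 dv vM e0.
have f0 k w : 0 <= f k w by case: (fC k).
pose Z m w : R := \sum_(0 <= k < m) v (maxn n k) * f k w.
have ZMC m : mean_le P (Z m) (M * C).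
  by apply: mean_leW (mean_le_sum _ _ fC); rewrite ?ler_wpM2r.
pose A m := [set w | eps <= Z m w].
have mA m : measurable (A m) by apply: measurable_superlevel; case: (ZMC m).
have PA m : (P (A m) <= (1 / eps * (M * C))%:E)%E by exact: mean_le_markov.
have dA : {homo A : i j / (i <= j)%N >-> (i <= j)%O}.
  move=> i j ij; apply/subsetPset => w /= /le_trans; apply.
  rewrite /Z (big_cat_nat (n := i) (p := j))//= lerDl.
  by apply: sumr_ge0 => k _; rewrite mulr_ge0.
pose B i := [set w | eps <= g i w].
have mB i : measurable (B i) by exact: measurable_superlevel.
apply: (@le_trans _ _ (P (\bigcup_m A m))).
  apply: le_measure; rewrite ?inE.
  - rewrite (_ : [set _ | _] = \bigcup_(i in [set i | (n <= i)%N]) B i).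
      exact: bigcup_measurable.
    by apply/seteqP; split => w /= [i]; [move=> [ni]|]; exists i.
  - exact: bigcupT_measurable.
  move=> w /= [i [ni]] /le_trans eS; exists i.+1 => //; apply: eS.
  by apply: le_trans (gS _ _) _; exact: weighted_sum_le_majorant.
have := @nondecreasing_cvg_mu _ _ _ P A mA (bigcupT_measurable _ mA) dA.
move=> /cvg_lim <-//; apply: lime_le.
  apply: ereal_nondecreasing_is_cvgn => i j /dA/subsetPset ij.
  by rewrite le_measure ?inE.
by apply: nearW => m; exact: PA.
Qed.

Lemma mean_le_norm (R : realType) (X : normedModType R)
    (d : measure_display) (Omega : measurableType d) (P : probability Omega R)
    (f : Omega -> X) (a : R) : X_random_variable f ->
  ('E_P[(fun w => `|f w|)%R] <= a%:E)%E -> mean_le P (fun w => `|f w|) a.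
Proof. by move=> mf fa; split => //; exact: measurable_norm_random_variable. Qed.

(** * Pointwise recursion for the gaps *)

(** Relative to the anchor, y n - u = (1 - 2 / (n + 2)) B n with
    B n = T (x n) + xi n - u. Once multiplied by (n + 2) (n + 3), the
    difference of two consecutive terms is q (B n - B n.+1) - 2 B n with
    q = (n + 1) (n + 2), and nonexpansiveness bounds the first part. *)
Lemma halpern_gap_le (R : realType) (X : normedModType R) (Omega : Type)
    (T U : X -> X) (beta : nat -> R) (x0 u : Omega -> X)
    (xi delta x y : nat -> Omega -> X) (n : nat) (w : Omega) :
  nonexpansive T ->
  halpern_mann T U (fun n => 2 / (n + 2)%:R) beta x0 u xi delta x y ->
  (n + 2)%:R * (n + 3)%:R * `|y n w - y n.+1 w|
    <= (n + 1)%:R * (n + 2)%:R * `|x n w - x n.+1 w|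
       + (n + 2)%:R * (n + 3)%:R * (`|xi n w| + `|xi n.+1 w|)
       + 2 * `|T (x n w) - u w|.
Proof.
move=> nT [_ yE _].
pose B k := T (x k w) + xi k w - u w.
have yB k : y k w - u w = (1 - 2 / (k + 2)%:R) *: B k.
  by rewrite yE /B scalerBr [X in _ = _ - X]scalerBl scale1r opprB addrA.
have n0 : 0 <= n%:R :> R by exact: ler0n.
set q : R := (n + 1)%:R * (n + 2)%:R.
have gapE : ((n + 2)%:R * (n + 3)%:R) *: (y n w - y n.+1 w)
    = q *: (B n - B n.+1) - 2 *: B n.
  have -> : y n w - y n.+1 w = (y n w - u w) - (y n.+1 w - u w).
    by rewrite opprB addrA subrK.
  rewrite !yB [LHS]scalerBr !scalerA [in RHS]scalerBr [RHS]addrAC -scalerBl.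
  by congr (_ *: _ - _ *: _); rewrite /q ?addSn !(natrD, mulrS);
    field; rewrite ?gt_eqF//; lra.
have q0 : 0 <= q by exact: mulr_ge0.
have -> : (n + 2)%:R * (n + 3)%:R * `|y n w - y n.+1 w|
    = `|q *: (B n - B n.+1) - 2 *: B n|.
  by rewrite -gapE normrZ ger0_norm// mulr_ge0.
have BB : `|B n - B n.+1| <= `|x n w - x n.+1 w| + (`|xi n w| + `|xi n.+1 w|).
  have -> : B n - B n.+1 =
      (T (x n w) - T (x n.+1 w)) + (xi n w - xi n.+1 w).
    by rewrite /B opprB addrA subrK opprD addrACA.
  apply: le_trans (ler_normD _ _) _; apply: lerD; first exact: nT.
  exact: ler_normB.
have Bn : `|B n| <= `|T (x n w) - u w| + `|xi n w|.
  by rewrite /B addrAC; exact: ler_normD.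
apply: le_trans (ler_normB _ _) _.
rewrite [`|q *: _|]normrZ [`|2 *: _|]normrZ (ger0_norm q0) (@ger0_norm _ 2)//.
have xi0 := normr_ge0 (xi n w).
have xi1 := normr_ge0 (xi n.+1 w).
have qBB := ler_wpM2l q0 BB.
(* xi n enters with the factor q + 2, which is at most (n + 2) (n + 3). *)
have : q * (`|xi n w| + `|xi n.+1 w|) + 2 * `|xi n w| <=
    (n + 2)%:R * (n + 3)%:R * (`|xi n w| + `|xi n.+1 w|).
  have Na := mulr_ge0 n0 xi0; have Nb := mulr_ge0 n0 xi1.
  by rewrite /q !natrD; nra.
move: qBB; clearbody q; lra.
Qed.

Lemma mann_gap_le (R : realType) (X : normedModType R) (Omega : Type)
    (T U : X -> X) (alpha : nat -> R) (beta : R) (x0 u : Omega -> X)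
    (xi delta x y : nat -> Omega -> X) (n : nat) (w : Omega) :
  nonexpansive U -> 0 < beta < 1 ->
  halpern_mann T U alpha (fun=> beta) x0 u xi delta x y ->
  `|x n.+1 w - x n.+2 w|
    <= `|y n w - y n.+1 w| + (`|delta n w| + `|delta n.+1 w|).
Proof.
move=> nU /andP[b0 b1] [_ _ xE].
rewrite !xE opprD addrACA -!scalerBr opprD addrACA.
apply: le_trans (ler_normD _ _) _; rewrite !normrZ.
rewrite ger0_norm; last by lra.
rewrite ger0_norm; last by lra.
have : `|U (y n w) - U (y n.+1 w) + (delta n w - delta n.+1 w)|
    <= `|y n w - y n.+1 w| + (`|delta n w| + `|delta n.+1 w|).
  apply: le_trans (ler_normD _ _) _; apply: lerD; first exact: nU.
  exact: ler_normB.
have d0 := normr_ge0 (delta n w).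
have d1 := normr_ge0 (delta n.+1 w).
nra.
Qed.

(** What the rescaled distance (n + 2) (n + 3) |y n - y n.+1| may gain when
    passing from n - 1 to n. The value at 0 bounds the initial term
    6 |y 0 - y 1|; there y 0 is the anchor itself, because the first anchoring
    coefficient is 1, so only T (x 1) and xi 1 enter. *)
Definition gap_increment (R : realType) (X : normedModType R) (Omega : Type)
    (T : X -> X) (u : Omega -> X) (xi delta x : nat -> Omega -> X)
    (n : nat) (w : Omega) : R :=
  if n is k.+1 then
    2 * `|T (x n w) - u w|
    + (k + 2)%:R * (k + 3)%:R * (`|delta k w| + `|delta n w|)
    + (k + 3)%:R * (k + 4)%:R * (`|xi n w| + `|xi n.+1 w|)
  else 2 * (`|T (x 1%N w) - u w| + `|xi 1%N w|).

(** Halpern and Mann gaps feed into each other with the factors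
    (n + 2) (n + 3) matching exactly, which is the point of the choice
    2 / (n + 2): the rescaled recursion has coefficient 1. *)
Lemma gap_le_sum (R : realType) (X : normedModType R) (Omega : Type)
    (T U : X -> X) (beta : R) (x0 u : Omega -> X)
    (xi delta x y : nat -> Omega -> X) (n : nat) (w : Omega) :
  nonexpansive T -> nonexpansive U -> 0 < beta < 1 ->
  halpern_mann T U (fun n => 2 / (n + 2)%:R) (fun=> beta) x0 u xi delta x y ->
  `|y n w - y n.+1 w| <= ((n + 2)%:R * (n + 3)%:R)^-1
    * \sum_(0 <= k < n.+1) gap_increment T u xi delta x k w.
Proof.
move=> nT nU b01 hm.
rewrite ler_pdivlMl; last by rewrite mulr_gt0// ltr0n addnS.
elim: n => [|n ih].
  have [_ yE _] := hm.
  rewrite big_nat1 /= !yE add0n divff ?pnatr_eq0// subrr scale0r add0r scale1r.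
  have -> : 2 / (1 + 2)%:R = 2 / 3 :> R by [].
  have -> : u w - ((1 - 2 / 3) *: (T (x 1%N w) + xi 1%N w) + (2 / 3) *: u w)
      = (3^-1 : R) *: (u w - (T (x 1%N w) + xi 1%N w)).
    rewrite (_ : 1 - 2 / 3 = 3^-1); last by field.
    rewrite scalerBr opprD addrA addrAC -[X in X - _ - _]scale1r -scalerBl.
    by rewrite (_ : 1 - 2 / 3 = 3^-1)//; field.
  rewrite normrZ ger0_norm// distrC addrAC.
  have := ler_normD (T (x 1%N w) - u w) (xi 1%N w).
  by rewrite (_ : 2%:R * (0 + 3)%:R = 6 :> R)//; lra.
rewrite big_nat_recr//=.
have h1 := halpern_gap_le n.+1 w nT hm.
have h2 := mann_gap_le n w nU b01 hm.
have h3 := ler_wpM2l (mulr_ge0 (ler0n R (n + 2)) (ler0n R (n + 3))) h2.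
move: h1; rewrite !addSn -!addnS => h1.
apply: le_trans h1 _.
move: h3; rewrite mulrDr; lra.
Qed.

(** * Means of the increments and the weights *)

(** The ratios (m + 1) / m and m / (m + 1) are at most 2 and 1: this is where
    quadratic decay of the noise compensates the quadratic weights. *)
Lemma consecutive_square_bound (R : realType) (K : R) (m : nat) :
  0 <= K -> (0 < m)%N ->
  m%:R * m.+1%:R * (K / m%:R ^+ 2 + K / m.+1%:R ^+ 2) <= 3 * K.
Proof.
move=> K0; rewrite -(ler1n R) mulrSr => m1.
have -> : m%:R * (m%:R + 1) * (K / m%:R ^+ 2 + K / (m%:R + 1) ^+ 2)
    = K * ((m%:R + 1) / m%:R + m%:R / (m%:R + 1)).
  by field; rewrite !gt_eqF//; lra.
rewrite [leRHS]mulrC; apply: ler_wpM2l => //.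
have : (m%:R + 1) / m%:R <= 2 :> R by rewrite ler_pdivrMr; lra.
have : m%:R / (m%:R + 1) <= 1 :> R by rewrite ler_pdivrMr; lra.
lra.
Qed.

Lemma mean_le_gap_increment (R : realType) (X : normedModType R)
    (d : measure_display) (Omega : measurableType d) (P : probability Omega R)
    (T : X -> X) (u : Omega -> X) (xi delta x : nat -> Omega -> X)
    (K0 K1 K2 : R) (n : nat) :
  0 <= K1 -> 0 <= K2 ->
  (forall n, mean_le P (fun w => `|T (x n w) - u w|) K0) ->
  (forall n, mean_le P (fun w => `|xi n w|) (K1 / (n + 2)%:R ^+ 2)) ->
  (forall n, mean_le P (fun w => `|delta n w|) (K2 / (n + 2)%:R ^+ 2)) ->
  mean_le P (gap_increment T u xi delta x n) (2 * K0 + 3 * K1 + 3 * K2).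
Proof.
move=> K10 K20 TK xiK deltaK; case: n => [|n].
  apply: mean_leW (mean_leZ (ler0n R 2) (mean_leD (TK 1%N) (xiK 1%N))).
  by rewrite (_ : (1 + 2)%:R = 3)//; lra.
apply: mean_leW (mean_leD (mean_leD (mean_leZ (ler0n R 2) (TK n.+1))
  (mean_leZ (mulr_ge0 (ler0n R (n + 2)) (ler0n R (n + 3)))
     (mean_leD (deltaK n) (deltaK n.+1))))
  (mean_leZ (mulr_ge0 (ler0n R (n + 3)) (ler0n R (n + 4)))
     (mean_leD (xiK n.+1) (xiK n.+2)))).
have := @consecutive_square_bound R K2 n.+2 K20 isT.
have := @consecutive_square_bound R K1 n.+3 K10 isT.
by rewrite !(addn2, addn3, addn4) => h1 h2; rewrite addrAC; apply: lerD h2;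
  rewrite lerD2l.
Qed.

Definition gap_weight (R : realType) (n : nat) : R :=
  ((n + 2)%:R * (n + 3)%:R)^-1.

Lemma gap_weight_ge0 (R : realType) (n : nat) : 0 <= gap_weight R n.
Proof. by rewrite invr_ge0 mulr_ge0. Qed.

Lemma gap_weight_nonincreasing (R : realType) :
  {homo gap_weight R : i j / (i <= j)%N >-> j <= i}.
Proof.
move=> i j ij; rewrite /gap_weight lef_pV2 ?posrE -?natrM ?ltr0n ?addnS//.
by rewrite ler_nat leq_mul// !ltnS leq_add2r.
Qed.

(** The first n + 1 weights all equal the one of index n, and the later ones
    telescope: 1 / ((k + 2) (k + 3)) = 1 / (k + 2) - 1 / (k + 3). *)
Lemma sum_gap_weight_max_le (R : realType) (n m : nat) :
  \sum_(0 <= k < m) gap_weight R (maxn n k) <= 2 / (n + 2)%:R.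
Proof.
have n0 : 0 <= n%:R :> R by exact: ler0n.
have tail j : \sum_(0 <= k < n.+1 + j) gap_weight R (maxn n k)
    <= 2 / (n + 2)%:R - (n + j + 3)%:R^-1.
  elim: j => [|j ih].
    rewrite !addn0 (eq_big_nat _ _ (F2 := fun=> gap_weight R n)); last first.
      by move=> k /andP[_ kn]; rewrite (maxn_idPl _).
    rewrite big_const_nat iter_addr_0 subn0 -mulr_natl /gap_weight.
    rewrite -subr_ge0 !(natrD, mulrS).
    rewrite (_ : _ - _ - _ = 3 / ((n%:R + 2) * (n%:R + 3))).
      by rewrite divr_ge0// mulr_ge0// addr_ge0.
    by field; rewrite !gt_eqF//; lra.
  rewrite addnS big_nat_recr//=; apply: le_trans (lerD ih (lexx _)) _.
  rewrite (maxn_idPr _); last by rewrite addSn -addnS leq_addr.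
  have j0 : 0 <= j%:R :> R by exact: ler0n.
  rewrite /gap_weight le_eqVlt; apply/orP; left; apply/eqP.
  rewrite !(natrD, mulrS, addSn, addnS); field.
  by rewrite !gt_eqF//; lra.
apply: (@le_trans _ _ (\sum_(0 <= k < n.+1 + m) gap_weight R (maxn n k))).
  rewrite [leRHS](big_cat_nat (n := m))//= ?leq_addl// lerDl.
  by apply: sumr_ge0 => k _; exact: gap_weight_ge0.
apply: le_trans (tail m) _.
by rewrite gerBl invr_ge0.
Qed.

(** * Rates of convergence *)

Theorem theorem4p6 :
  exists a b c a' b' c' : nat,
  forall (R : realType) (X : normedModType R)
    (d : measure_display) (Omega : measurableType d) (P : probability Omega R)
    (T U : X -> X) (x0 u : Omega -> X) (xi delta x y : nat -> Omega -> X)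
    (beta K1 K2 : R) (K0 : nat),
  separable X ->
  nonexpansive T -> nonexpansive U ->
  X_random_variable x0 -> X_random_variable u ->
  (forall n, X_random_variable (xi n)) ->
  (forall n, X_random_variable (delta n)) ->
  0 <= K1 -> 0 <= K2 ->
  0 < beta < 1 ->
  halpern_mann T U (fun n => 2 / (n + 2)%:R) (fun=> beta) x0 u xi delta x y ->
  (0 < K0)%N ->
  (forall n, [/\ ('E_P[(fun w => `|T (x n w) - u w|)%R] <= K0%:R%:E)%E,
                 ('E_P[(fun w => `|U (y n w) - y n w|)%R] <= K0%:R%:E)%E,
                 ('E_P[(fun w => `|U (u w) - u w|)%R] <= K0%:R%:E)%E
               & ('E_P[(fun w => `|U (y n w) - u w|)%R] <= K0%:R%:E)%E]) ->
  (forall n,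
    ('E_P[(fun w => `|xi n w|)%R] <= (K1 / (n + 2)%:R ^+ 2)%:E)%E) ->
  (forall n,
    ('E_P[(fun w => `|delta n w|)%R] <= (K2 / (n + 2)%:R ^+ 2)%:E)%E) ->
  let L := a%:R * K0%:R + b%:R * K1 + c%:R * K2 in
  let L' := a'%:R * K0%:R + b'%:R * K1 + c'%:R * K2 in
  (forall n,
    ('E_P[(fun w => `|y n w - y n.+1 w|)%R] <= (2 * L / (n + 2)%:R)%:E)%E) /\
  ((exists Y : {RV P >-> R},
      [/\ forall w, 0 <= Y w,
          ('E_P[Y] <= K0%:R%:E)%E
        & forall n, {ae P, forall w,
            [/\ `|T (x n w) - u w| <= Y w,
                `|U (y n w) - y n w| <= Y w,
                `|U (u w) - u w| <= Y w
              & `|U (y n w) - u w| <= Y w]}]) ->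
   forall (n : nat) (eps : R), 0 < eps ->
    (P [set w | exists i : nat,
          (n <= i)%N /\ (eps <= `|y i w - y i.+1 w|)%R]
     <= (1 / eps * (4 * L' / (n + 2)%:R))%:E)%E).
Proof.
(* L and L' coincide: the mean bound of the increments serves both claims. *)
exists 2%N, 3%N, 3%N, 2%N, 3%N, 3%N.
move=> R X d Omega P T U x0 u xi delta x y beta K1 K2 K0 sX nT nU mx0 mu mxi mdelta.
move=> K10 K20 b01 hm _ EK xiK deltaK L L'.
have mxy := halpern_mann_random_variable sX nT nU mx0 mu mxi mdelta hm.
have mT k : X_random_variable (fun w => T (x k w) - u w).
  apply: random_variableB => //.
  apply: (random_variable_comp (nonexpansive_continuous nT)).
  by case: (mxy k).
pose f := gap_increment T u xi delta x.
have fL k : mean_le P (f k) L.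
  apply: mean_le_gap_increment => // j; apply: mean_le_norm => //.
  by case: (EK j).
pose g i w := `|y i w - y i.+1 w|.
have mg i : measurable_fun [set: Omega] (g i).
  apply: measurable_norm_random_variable; apply: random_variableB => //.
    by case: (mxy i).
  by case: (mxy i.+1).
have gS i w : g i w <= gap_weight R i * \sum_(0 <= k < i.+1) f k w.
  exact: gap_le_sum nT nU b01 hm.
have L0 : 0 <= L by rewrite !(addr_ge0, mulr_ge0).
split=> [n | _ n eps e0].
  (* At i = n the majorant of the tail estimate also bounds the mean of one
     gap. *)
  suff [_ _ //] : mean_le P (g n) (2 * L / (n + 2)%:R).
  apply: mean_le_ge (mg n) _ _ (mean_leW _ (mean_le_sum n.+1
    (fun k => gap_weight_ge0 R (maxn n k)) fL)).
  - by move=> w; exact: normr_ge0.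
  - move=> w; apply: le_trans (gS n w) _.
    apply: weighted_sum_le_majorant => //; first by move=> k; case: (fL k).
    exact: gap_weight_nonincreasing.
  - by rewrite mulrAC; apply: ler_wpM2r => //; exact: sum_gap_weight_max_le.
apply: le_trans (maximal_inequality mg gS fL L0 (@gap_weight_ge0 R)
  (@gap_weight_nonincreasing R) (@sum_gap_weight_max_le R n) e0) _.
rewrite lee_fin; apply: ler_wpM2l; first by rewrite divr_ge0// ltW.
rewrite mulrAC; apply: ler_wpM2r; first by rewrite invr_ge0.
by apply: (ler_wpM2r L0); rewrite ler_nat.
Qed.
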